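(* Let $R$ be a commutative ring with identity and $M$ a finitely generated faithful multiplication $R$-module. Then $M$ is coprimely structured if and only if $R$ is coprimely structured.
   Context: All modules are unital. A multiplication module is an $R$-module $M$ such that each submodule $N$ of $M$ is of the form $N=IM$ for some ideal $I$ of $R$. A prime submodule of $M$ is a proper submodule $P$ such that $rm\in P$ with $r\in R$, $m\in M$ implies $m\in P$ or $rM\subseteq P$. A prime submodule $P$ of $M$ is called coprimely structured if for every family $\{N_i\}_{i\in I}$ of submodules of $M$ with $N_i+P=M$ for all $i\in I$, one has $\bigcap_{i\in I}N_i\not\subseteq P$. An $R$-module is called coprimely structured if each of its prime submodules is coprimely structured. The ring $R$ is coprimely structured if it is so as a module over itself, i.e. for every prime ideal $P$ of $R$ and every family $\{I_\alpha\}_{\alpha\in A}$ of ideals with $I_\alpha+P=R$ for all $\alpha\in A$, one has $\bigcap_{\alpha\in A}I_\alpha\not\subseteq P$. *)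

(* Defs.v *)
From mathcomp Require Import all_boot all_order all_algebra.
From mathcomp Require Import boolp classical_sets.

Set Implicit Arguments.
Unset Strict Implicit.
Unset Printing Implicit Defensive.

Import GRing.Theory.

Local Open Scope classical_set_scope.
Local Open Scope ring_scope.

(* Submodules need not be decidable, so they are Prop-valued sets. The ideals
   of R are the submodules of R^o; the library's idealr_closed is not used
   because it only allows proper ideals. Rings may be trivial. *)
Definition is_submodule (R : comPzRingType) (M : lmodType R) (N : set M) : Prop :=
  GRing.submod_closed [in N].

Definition is_ideal (R : comPzRingType) (I : set R) : Prop :=
  is_submodule (I : set R^o).

Definition submodule_add (R : comPzRingType) (M : lmodType R) (N P : set M) :
    set M :=
  [set x + y | x in N & y in P].

(* The submodule I M : finite sums of products a *: m with a in I. *)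
Definition ideal_smul (R : comPzRingType) (M : lmodType R) (I : set R) :
    set M :=
  [set x | exists (n : nat) (a : 'I_n -> R) (m : 'I_n -> M),
     (forall i, I (a i)) /\ x = \sum_(i < n) a i *: m i].

Definition multiplication_module (R : comPzRingType) (M : lmodType R) : Prop :=
  forall N : set M, is_submodule N ->
    exists I : set R, is_ideal I /\ N = ideal_smul I.

Definition finitely_generated (R : comPzRingType) (M : lmodType R) : Prop :=
  exists (n : nat) (g : 'I_n -> M),
    forall x : M, exists c : 'I_n -> R, x = \sum_(i < n) c i *: g i.

Definition faithful_module (R : comPzRingType) (M : lmodType R) : Prop :=
  forall r : R, (forall m : M, r *: m = 0) -> r = 0.

Definition prime_submodule (R : comPzRingType) (M : lmodType R) (P : set M) :
    Prop :=
  [/\ is_submodule P, P <> setT &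
      forall (r : R) (m : M), P (r *: m) -> P m \/ forall x : M, P (r *: x)].

Definition coprimely_structured_submodule (R : comPzRingType) (M : lmodType R)
    (P : set M) : Prop :=
  forall (A : Type) (N : A -> set M),
    (forall i, is_submodule (N i)) ->
    (forall i, submodule_add (N i) P = setT) ->
    ~ (\bigcap_i N i `<=` P).

Definition coprimely_structured_module (R : comPzRingType) (M : lmodType R) :
    Prop :=
  forall P : set M, prime_submodule P -> coprimely_structured_submodule P.

Definition coprimely_structured_ring (R : comPzRingType) : Prop :=
  coprimely_structured_module R^o.

(* Main.v *)
Require Import Defs.
From mathcomp Require Import all_boot all_order all_algebra.
From mathcomp Require Import boolp classical_sets ring.

(** The map [I |-> I M] from ideals of [R] to submodules of [M] is onto because
    [M] is a multiplication module.  It also reflects inclusion.  Suppose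
    [a M <= J M], let [g] be one of the generators and write [R g = I M].  Then
    [a g] lies in [a I M <= I J M = J g], so [(a - j) g = 0] for some [j] in
    [J]; as [I M = R g], every [s] in [I] satisfies [s (a - j) M = 0], and
    faithfulness gives [s a = s j], an element of [J].  Hence the ideal
    [K = (J : a)] contains [I], so it satisfies [K M = M], and Nakayama's lemma
    yields [1] in [K].  Prime submodules, comaximality and intersections
    therefore correspond on the two sides. *)

Set Implicit Arguments.
Unset Strict Implicit.
Unset Printing Implicit Defensive.

Import GRing.Theory.

Local Open Scope classical_set_scope.
Local Open Scope ring_scope.

(** * Closure properties of submodules and of products [I M] *)

Lemma is_submoduleP (R : comPzRingType) (M : lmodType R) (N : set M) :
  is_submodule N <->
  [/\ N 0, forall x y, N x -> N y -> N (x + y)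
         & forall a x, N x -> N (a *: x)].
Proof.
split=> [[N0 NL]|[N0 ND NZ]].
  have {}N0 : N 0 by move: N0; rewrite inE.
  have {}NL a x y : N x -> N y -> N (a *: x + y).
    by move=> Nx Ny; have := NL a x y; rewrite !inE; apply.
  split=> // [x y Nx Ny|a x Nx]; first by rewrite -[x]scale1r; apply: NL.
  by rewrite -[_ *: _]addr0; apply: NL.
split=> [|a x y]; first by rewrite inE.
by rewrite !inE => Nx Ny; apply: ND => //; apply: NZ.
Qed.

Lemma is_idealP (R : comPzRingType) (I : set R) :
  is_ideal I <->
  [/\ I 0, forall a b, I a -> I b -> I (a + b)
         & forall r a, I a -> I (r * a)].
Proof. exact: (is_submoduleP (I : set R^o)). Qed.

Section Submodules.
Variables (R : comPzRingType) (M : lmodType R).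
Implicit Types (N P : set M) (I J : set R).

Lemma submodule_sum N n (F : 'I_n -> M) :
  is_submodule N -> (forall i, N (F i)) -> N (\sum_(i < n) F i).
Proof. by case/is_submoduleP=> N0 ND _ NF; apply: (big_ind N). Qed.

Lemma is_submodule_add N P :
  is_submodule N -> is_submodule P -> is_submodule (submodule_add N P).
Proof.
move=> /is_submoduleP[N0 ND NZ] /is_submoduleP[P0 PD PZ].
apply/is_submoduleP; split=> [|_ _ [x Nx [y Py <-]] [z Nz [t Pt <-]]|
  a _ [x Nx [y Py <-]]].
- by exists 0 => //; exists 0 => //; rewrite addr0.
- by rewrite addrACA; exists (x + z); [exact: ND | exists (y + t); [exact: PD|]].
- by rewrite scalerDr; exists (a *: x); [exact: NZ | exists (a *: y); [exact: PZ|]].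
Qed.

Lemma is_submodule_bigcap (A : Type) (N : A -> set M) :
  (forall i, is_submodule (N i)) -> is_submodule (\bigcap_i N i).
Proof.
move=> subN; apply/is_submoduleP; split=> [i _|x y Nx Ny i _|a x Nx i _];
  have /is_submoduleP[N0 ND NZ] := subN i; [exact: N0| |].
- by apply: ND; [exact: Nx | exact: Ny].
- by apply: NZ; exact: Nx.
Qed.

(** With [ideal_smul_sub], this lets elements of [I M] be rewritten with the fixed generators of [M]
    and coefficients in [I]. *)
Lemma is_submodule_combinations I n (g : 'I_n -> M) :
  is_ideal I ->
  is_submodule [set x | exists c : 'I_n -> R,
    (forall i, I (c i)) /\ x = \sum_(i < n) c i *: g i].
Proof.
move=> /is_idealP[zeroI addI mulI].
apply/is_submoduleP; split=> [|_ _ [c [Ic ->]] [d [Id ->]]|a _ [c [Ic ->]]].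
- by exists (fun=> 0); split=> //; rewrite big1 // => i _; rewrite scale0r.
- exists (fun i => c i + d i); split=> [i|]; first exact: addI.
  by rewrite -big_split; apply: eq_bigr => i _; rewrite scalerDl.
- exists (fun i => a * c i); split=> [i|]; first exact: mulI.
  by rewrite scaler_sumr; apply: eq_bigr => i _; rewrite scalerA.
Qed.

Lemma is_submodule_multiples I (g : M) :
  is_ideal I -> is_submodule [set x | exists2 j, I j & x = j *: g].
Proof.
move=> /is_idealP[zeroI addI mulI].
apply/is_submoduleP; split=> [|_ _ [j Ij ->] [k Ik ->]|a _ [j Ij ->]].
- by exists 0; rewrite ?scale0r.
- by exists (j + k); [exact: addI | rewrite scalerDl].
- by exists (a * j); [exact: mulI | rewrite scalerA].
Qed.

Lemma is_ideal_setT : is_ideal [set: R].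
Proof. by apply/is_idealP. Qed.

Lemma ideal_smul_in I a (m : M) : I a -> ideal_smul I (a *: m).
Proof.
by move=> Ia; exists 1%N, (fun=> a), (fun=> m); rewrite big_ord1.
Qed.

Lemma ideal_smul_sub I N :
  is_submodule N -> (forall a m, I a -> N (a *: m)) -> ideal_smul I `<=` N.
Proof.
move=> subN IN _ [n [a [m [Ia ->]]]].
by apply: submodule_sum => // i; exact: IN.
Qed.

Lemma is_submodule_ideal_smul I :
  is_ideal I -> is_submodule (ideal_smul I : set M).
Proof.
move=> /is_idealP[zeroI addI mulI].
apply/is_submoduleP; split=> [|_ _ [n [a [m [Ia ->]]]] [k [b [p [Ib ->]]]]|
  r _ [n [a [m [Ia ->]]]]].
- by rewrite -(scale0r 0); exact: ideal_smul_in.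
- exists (n + k)%N, (fun i => match split i with inl j => a j | inr j => b j end),
    (fun i => match split i with inl j => m j | inr j => p j end).
  split=> [i|]; first by case: split.
  rewrite big_split_ord /=; congr (_ + _); apply: eq_bigr => i _.
    by rewrite (unsplitK (inl i)).
  by rewrite (unsplitK (inr i)).
- exists n, (fun i => r * a i), m; split=> [i|]; first exact: mulI.
  by rewrite scaler_sumr; apply: eq_bigr => i _; rewrite scalerA.
Qed.

Lemma ideal_smulS I J :
  is_ideal J -> I `<=` J -> ideal_smul I `<=` (ideal_smul J : set M).
Proof.
move=> idJ IJ; apply: ideal_smul_sub; first exact: is_submodule_ideal_smul.
by move=> a m /IJ; exact: ideal_smul_in.
Qed.

Lemma ideal_smulT : ideal_smul [set: R] = [set: M].
Proof.
by rewrite predeqE => x; split=> // _; rewrite -[x]scale1r; exact: ideal_smul_in.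
Qed.

(** Nakayama's lemma without determinants, by induction on the number of generators. The factor [e]
    stays congruent to 1 modulo [I] while generators are removed; once none is left, the sum is
    empty and [e] kills [M]. *)
Lemma annihilator_of_combinations I : is_ideal I ->
  forall n (g : 'I_n -> M) e, I (1 - e) ->
  (forall x : M, exists c : 'I_n -> R,
     (forall i, I (c i)) /\ e *: x = \sum_(i < n) c i *: g i) ->
  exists2 e', I (1 - e') & forall x : M, e' *: x = 0.
Proof.
move=> idI; have /is_idealP[zeroI addI mulI] := idI.
elim=> [|n IHn] g e Ie eg.
  by exists e => // x; have [c [_ ->]] := eg x; rewrite big_ord0.
have [c [Ic]] := eg (g ord_max).
rewrite big_ord_recr /= => /eqP; rewrite -subr_eq -scalerBl => /eqP gmax.
(* Multiplying by [e - c ord_max] eliminates the last generator. *)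
apply: (IHn (fun i => g (widen_ord (leqnSn n) i)) ((e - c ord_max) * e)).
  have -> : 1 - (e - c ord_max) * e = (1 - e) + (e * (1 - e) + e * c ord_max).
    by ring.
  by apply: (addI) => //; apply: addI; exact: mulI.
move=> x; have [d [Id ex]] := eg x.
(* After scaling by [e - c ord_max], the relation [gmax] turns the last term of [e *: x] into a
   combination of the other generators. *)
exists (fun i => (e - c ord_max) * d (widen_ord (leqnSn n) i)
                 + d ord_max * c (widen_ord (leqnSn n) i)).
split=> [i|]; first by apply: addI; exact: mulI.
rewrite -scalerA ex big_ord_recr /= scalerDr scaler_sumr.
rewrite scalerA mulrC -scalerA gmax scaler_sumr -big_split /=.
by apply: eq_bigr => i _; rewrite !scalerA -scalerDl.
Qed.

(** Starting from [e = 1], elimination yields an element congruent to 1 modulo [I] that kills [M];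
    by faithfulness it is 0. *)
Lemma faithful_nakayama I :
  finitely_generated M -> faithful_module M -> is_ideal I ->
  ideal_smul I = [set: M] -> I 1.
Proof.
move=> [n [g gen]] faithful idI IM.
have [|x|e Ie eM] := @annihilator_of_combinations _ idI n g 1.
- by rewrite subrr; case/is_idealP: idI.
- rewrite scale1r.
  have : [set: M] x by [].
  rewrite -IM; move: x; apply: ideal_smul_sub (is_submodule_combinations g idI) _.
  move=> a m Ia; have [c ->] := gen m; exists (fun i => c i * a).
  split=> [i|]; first by case/is_idealP: idI => _ _; apply.
  by rewrite scaler_sumr; apply: eq_bigr => i _; rewrite scalerA mulrC.
- by move: Ie; rewrite (faithful e) // subr0.
Qed.

End Submodules.

(** * The correspondence between ideals of [R] and submodules of [M] *)

Section Correspondence.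
Variables (R : comPzRingType) (M : lmodType R).
Hypotheses (M_fg : finitely_generated M) (M_faithful : faithful_module M)
  (M_mult : multiplication_module M).
Implicit Types (P : set M) (I J p : set R).

(** Each [s] in such an [I] maps all of [M] into [R g], which reduces questions about [M] to the
    single element [g]. *)
Lemma cyclic_submoduleE (g : M) :
  exists I, is_ideal I /\ forall x, ideal_smul I x <-> exists r, x = r *: g.
Proof.
have [I [idI E]] := M_mult (is_submodule_multiples g (is_ideal_setT R)).
exists I; split=> // x; rewrite -E.
by split=> [[r _ ->]|[r ->]]; exists r.
Qed.

Lemma ideal_smul_cancel J a :
  is_ideal J -> (forall x : M, ideal_smul J (a *: x)) -> J a.
Proof.
move=> idJ aM; have /is_idealP[zeroJ addJ mulJ] := idJ.
pose K := [set r | J (r * a)].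
have idK : is_ideal K.
  apply/is_idealP; rewrite /K; split=> [|x y Kx Ky|r x Kx] /=.
  - by rewrite mul0r.
  - by rewrite mulrDl; exact: addJ.
  - by rewrite -mulrA; exact: mulJ.
suff : K 1 by rewrite /K /= mul1r.
apply: (faithful_nakayama M_fg) => //.
rewrite predeqE => x; split=> // _.
(* It is enough that every generator [g i] lies in [K M]. *)
have [n [g gen]] := M_fg; have [c ->] := gen x.
have subKM := is_submodule_ideal_smul M idK.
apply: submodule_sum => // i; case/is_submoduleP: (subKM) => _ _; apply.
have [I [idI IM]] := cyclic_submoduleE (g i).
have gI : ideal_smul I (g i) by apply/IM; exists 1; rewrite scale1r.
(* As [s] sends each [q l] into [R g i], it sends [b l *: q l] to a multiple of [g i] with factor in
   [J]. *)
have scaleJ s m : I s -> ideal_smul J m -> exists2 j, J j & s *: m = j *: g i.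
  move=> Is [k [b [q [Jb ->]]]]; rewrite scaler_sumr.
  apply: (submodule_sum (is_submodule_multiples (g i) idJ)) => l.
  have /IM[r sq] := ideal_smul_in (q l) Is.
  exists (r * b l); first exact: mulJ.
  by rewrite scalerA mulrC -scalerA sq scalerA mulrC.
have scale_a y : ideal_smul I y -> exists2 j, J j & a *: y = j *: g i.
  move=> [k [s [m [Is ->]]]]; rewrite scaler_sumr.
  apply: (submodule_sum (is_submodule_multiples (g i) idJ)) => l.
  by rewrite scalerA mulrC -scalerA; exact: scaleJ.
have [j Jj ag] := scale_a _ gI.
(* Since [g i] lies in [I M], the inclusion of [I] in [K] suffices. *)
apply: ideal_smulS gI => // s Is.
suff /eqP : s * (a - j) = 0.
  by rewrite /K /= mulrBr subr_eq0 => /eqP->; exact: mulJ.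
(* The element [s *: m] is a multiple of [g i], and [a - j] kills [g i]. *)
apply: M_faithful => m; have /IM[r sm] := ideal_smul_in m Is.
by rewrite mulrC -scalerA sm scalerA mulrC -scalerA scalerBl ag subrr scaler0.
Qed.

Lemma ideal_smul_reflects_sub I J : is_ideal J ->
  ideal_smul I `<=` (ideal_smul J : set M) -> I `<=` J.
Proof.
move=> idJ IJ a Ia; apply: ideal_smul_cancel => // x.
by apply: IJ; exact: ideal_smul_in.
Qed.

Lemma prime_ideal_smul p :
  prime_submodule (p : set R^o) -> prime_submodule (ideal_smul p : set M).
Proof.
move=> [idp pT p_prime]; split; first exact: is_submodule_ideal_smul.
  move=> pM; apply: pT; rewrite predeqE => a; split=> // _.
  by apply: ideal_smul_cancel => // x; rewrite pM.
move=> r m prm; have [I [idI IM]] := cyclic_submoduleE m.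
have [pr|npr] := pselect (p r); first by right=> x; exact: ideal_smul_in.
left; have mI : ideal_smul I m by apply/IM; exists 1; rewrite scale1r.
apply: ideal_smulS mI => // s Is.
(* For every [x], [s *: x] is a multiple of [m], so [r * s] maps [M] into [p M] and cancellation
   applies. As [r] is not in [p], primality then puts [s] in [p]. *)
have : p (r * s).
  apply: ideal_smul_cancel => // x; have /IM[t sx] := ideal_smul_in x Is.
  rewrite -scalerA sx scalerA mulrC -scalerA.
  by have /is_submoduleP[_ _] := is_submodule_ideal_smul M idp; apply.
case/p_prime=> // pr; case: npr.
by have := pr 1; rewrite /GRing.scale /= mulr1.
Qed.

(** The colon ideal [(P : M)], that is, the annihilator of [M / P] when [P] is a submodule. *)
Definition transporter P : set R := [set r | forall x : M, P (r *: x)].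

Lemma is_ideal_transporter P : is_submodule P -> is_ideal (transporter P).
Proof.
move=> /is_submoduleP[P0 PD PZ].
apply/is_idealP; split=> [x|r s Pr Ps x|a r Pr x].
- by rewrite scale0r.
- by rewrite scalerDl; exact: PD.
- by rewrite -scalerA; exact: PZ.
Qed.

Lemma prime_transporter P :
  prime_submodule P -> prime_submodule (transporter P : set R^o).
Proof.
move=> [subP PT P_prime]; split; first exact: is_ideal_transporter.
- move=> PE; apply: PT; rewrite predeqE => x; split=> // _.
  have : transporter P 1 by rewrite PE.
  by move/(_ x); rewrite scale1r.
- move=> r s Prs; have [Pr|nPr] := pselect (transporter P r).
    by right=> t x; rewrite -[_ *: t]/(r * t) -scalerA; exact: Pr.
  left=> x; have := Prs x; rewrite -[_ *: s]/(r * s) -scalerA.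
  by case/P_prime.
Qed.

(** Any ideal [I] with [P = I M] is contained in the transporter of [P]. *)
Lemma ideal_smul_transporter P :
  is_submodule P -> ideal_smul (transporter P) = P.
Proof.
move=> subP; rewrite eqEsubset; split.
  by apply: ideal_smul_sub => // a m; apply.
have [I [idI ->]] := M_mult subP.
move=> x [n [a [m [Ia ->]]]]; exists n, a, m; split=> // i y.
exact: ideal_smul_in.
Qed.

Lemma ideal_smul_add I J :
  is_ideal I -> is_ideal J ->
  ideal_smul (submodule_add (I : set R^o) J)
  = submodule_add (ideal_smul I) (ideal_smul J : set M).
Proof.
move=> idI idJ; have /is_idealP[zeroI _ _] := idI.
have /is_idealP[zeroJ _ _] := idJ.
have idIJ : is_ideal (submodule_add (I : set R^o) J) by exact: is_submodule_add.
rewrite eqEsubset; split.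
  apply: ideal_smul_sub => [|_ m [a Ia [b Jb <-]]].
    by apply: is_submodule_add; exact: is_submodule_ideal_smul.
  exists (a *: m); first exact: ideal_smul_in.
  by exists (b *: m); [exact: ideal_smul_in | rewrite scalerDl].
move=> _ [x Ix [y Jy <-]].
have /is_submoduleP[_ addIJ _] := is_submodule_ideal_smul M idIJ.
apply: addIJ.
  by apply: ideal_smulS Ix => // a Ia; exists a => //; exists 0 => //; rewrite addr0.
by apply: ideal_smulS Jy => // b Jb; exists 0 => //; exists b => //; rewrite add0r.
Qed.

Lemma coprimely_structured_ring_of_module :
  coprimely_structured_module M -> coprimely_structured_ring R.
Proof.
move=> csM p p_prime A I idI Ip Isub; have [idp _ _] := p_prime.
have {}idI i : @is_ideal R (I i) := idI i.
apply: (csM _ (prime_ideal_smul p_prime) A (fun i => @ideal_smul R M (I i))).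
- by move=> i; exact: is_submodule_ideal_smul (idI i).
- move=> i; rewrite -ideal_smul_add // -[RHS]ideal_smulT.
  by congr (@ideal_smul R M _); exact: Ip.
(* Products need not commute with infinite intersections, but the intersection of the [I i M] is
   some [J M], and reflecting inclusions puts [J] inside every [I i], hence inside [p]. *)
have [|J [idJ JE]] := M_mult (N := \bigcap_i @ideal_smul R M (I i)).
  by apply: is_submodule_bigcap => i; exact: is_submodule_ideal_smul (idI i).
rewrite JE; apply: ideal_smulS => // a Ja; apply: Isub => i _.
by apply: ideal_smul_reflects_sub Ja => //; rewrite -JE => x; apply.
Qed.

Lemma coprimely_structured_module_of_ring :
  coprimely_structured_ring R -> coprimely_structured_module M.
Proof.
move=> csR P P_prime A N subN NP Nsub; have [subP _ _] := P_prime.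
have idp := is_ideal_transporter subP.
have idN i : is_ideal (transporter (N i)) by exact: is_ideal_transporter.
apply: (csR _ (prime_transporter P_prime) A (fun i => transporter (N i))) => [//|i|a Na x].
(* The sum of the two transporters has product [N i + P = M] with [M], so by cancellation it
   contains every [a]. *)
- have sumM := ideal_smul_add (idN i) idp.
  rewrite !ideal_smul_transporter // NP in sumM.
  rewrite predeqE => a; split=> // _; apply: ideal_smul_cancel => [|x].
    exact: is_submodule_add (idN i) idp.
  by have : [set: M] (a *: x) by []; rewrite -sumM.
- by apply: Nsub => i _; exact: Na.
Qed.

End Correspondence.

Theorem theorem4p7 (R : comPzRingType) (M : lmodType R)
    (M_fg : finitely_generated M) (M_faithful : faithful_module M)
    (M_mult : multiplication_module M) :
  coprimely_structured_module M <-> coprimely_structured_ring R.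
Proof.
split; first exact: coprimely_structured_ring_of_module.
exact: coprimely_structured_module_of_ring.
Qed.
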